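(* For every positive integer $n$, $\mathit{pa}(n)=p_o^*(n)$.
   Context: A partition of a positive integer $n$ is a weakly decreasing sequence of positive integers with sum $n$. An unlimited parity alternating partition is a partition whose different parts alternate in parity: if the distinct part sizes are $d_1>d_2>\cdots>d_r$, then $d_i$ and $d_{i+1}$ have different parities for every $i$ (parts may be repeated). $\mathit{pa}(n)$ is the number of such partitions of $n$. $p_o^*(n)$ is the number of partitions of $n$ in which every part size other than the largest part appears an odd number of times (the largest part may appear any positive number of times). *)

(* Defs.v *)
From mathcomp Require Import all_boot.
Set Implicit Arguments.
Unset Strict Implicit.
Unset Printing Implicit Defensive.

Definition is_partition (n : nat) (s : seq nat) : bool :=
  [&& sorted geq s, all (ltn 0) s & sumn s == n].

(* A partition of [n] has at most [n] parts, each at most [n], so bounded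
   sequences over ['I_n.+1] miss none of them (see [num_partitionsE]). *)
Definition num_partitions (n : nat) (P : pred (seq nat)) : nat :=
  #|[set s : {bseq n of 'I_n.+1} |
      is_partition n (map val s) && P (map val s)]|.

(* On a weakly decreasing [s], [undup s] lists the distinct part sizes
   d_1 > d_2 > ... > d_r in this order. *)
Definition parity_alternating (s : seq nat) : bool :=
  sorted (fun a b => odd a != odd b) (undup s).

(* On a weakly decreasing [s], [head 0 s] is the largest part. *)
Definition nonlargest_odd_mult (s : seq nat) : bool :=
  all (fun d => (d != head 0 s) ==> odd (count_mem d s)) s.

Definition pa (n : nat) : nat := num_partitions n parity_alternating.

Definition po_star (n : nat) : nat := num_partitions n nonlargest_odd_mult.

Lemma size_le_sumn (s : seq nat) : all (ltn 0) s -> size s <= sumn s.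
Proof.
elim: s => //= a s IH /andP[a0 /IH h]; rewrite -add1n; exact: leq_add.
Qed.

Lemma mem_le_sumn (s : seq nat) (x : nat) : x \in s -> x <= sumn s.
Proof.
elim: s => //= a s IH; rewrite inE => /orP[/eqP->|/IH h].
  exact: leq_addr.
exact: leq_trans h (leq_addl _ _).
Qed.

Lemma num_partitionsE (n : nat) (P : pred (seq nat)) (l : seq (seq nat)) :
  uniq l -> (forall s, (s \in l) = is_partition n s && P s) ->
  num_partitions n P = size l.
Proof.
move=> ul meml; rewrite /num_partitions cardE.
set e := enum _.
rewrite -(size_map (fun s : {bseq n of 'I_n.+1} => map val s)).
apply/perm_size/uniq_perm => //.
  rewrite map_inj_uniq ?enum_uniq // => s t st.
  by apply/val_inj/(inj_map val_inj).
move=> s; rewrite meml; apply/mapP/idP => [[t]|sP].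
  by rewrite mem_enum inE => tP ->.
have /andP[/and3P[_ pos /eqP sm] _] := sP.
have sz : size (map (@inord n) s) <= n by rewrite size_map -[leqRHS]sm size_le_sumn.
have es : s = map val (map (@inord n) s).
  rewrite -map_comp -[LHS]map_id; apply/eq_in_map => x /mem_le_sumn xs /=.
  by rewrite inordK // ltnS -sm.
exists (Bseq sz); last exact: es.
by rewrite mem_enum inE /= -es.
Qed.

(* Main.v *)
Require Import Defs.
From mathcomp Require Import all_boot.
Set Implicit Arguments.
Unset Strict Implicit.
Unset Printing Implicit Defensive.

(** Conjugation of Ferrers diagrams is the bijection: the part size [d] occurs
    [s_d - s_{d+1}] times (parts indexed from 1) in the conjugate of [s], and
    the largest part of the conjugate is the number of parts of [s].  Hence all
    nonlargest part sizes of the conjugate have odd multiplicity iff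
    consecutive unequal parts of [s] differ by an odd number. *)

(** Columns are indexed from 0: column [i] has one cell for each part exceeding [i]. *)
Definition conj_part (s : seq nat) : seq nat :=
  [seq count (ltn i) s | i <- iota 0 (head 0 s)].

Lemma count_ltn_eq0 (a i : nat) (s : seq nat) :
  path geq a s -> a <= i -> count (ltn i) s = 0.
Proof.
move=> pas ai; apply/eqP; rewrite -leqn0 leqNgt -has_count; apply/hasPn => x xs.
rewrite -leqNgt (leq_trans _ ai) //.
have /allP := order_path_min (rev_trans leq_trans) pas; exact.
Qed.

(** Both sides say that the cell in row [j] and column [i] lies in the Ferrers diagram. *)
Lemma ltn_nth_count (s : seq nat) (i j : nat) :
  sorted geq s -> (i < nth 0 s j) = (j < count (ltn i) s).
Proof.
elim: s j => [|a s IH] j pas /=; first by rewrite nth_nil.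
have IHs := IH ^~ (path_sorted pas).
case: (ltnP i a) => [ia|ai]; case: j => [|j] //=; rewrite ?IHs //.
all: by rewrite (count_ltn_eq0 pas ai) // ltnNge ai.
Qed.

Lemma nth_le_head (s : seq nat) (j : nat) :
  sorted geq s -> nth 0 s j <= head 0 s.
Proof.
case: s j => [|a s] [|j] //= pas.
have [js|js] := ltnP j (size s); last by rewrite nth_default.
have /allP := order_path_min (rev_trans leq_trans) pas; apply; exact: mem_nth.
Qed.

Lemma count_ltn_iota (m k : nat) : m <= k -> count (fun i => i < m) (iota 0 k) = m.
Proof.
move=> mk; rewrite -(subnKC mk) iotaD count_cat add0n.
rewrite (_ : count _ (iota 0 m) = m); last first.
  rewrite -[RHS](size_iota 0); apply/eqP; rewrite -all_count.
  by apply/allP => i; rewrite mem_iota.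
rewrite (_ : count _ _ = 0) ?addn0 //; apply/eqP.
rewrite -leqn0 leqNgt -has_count; apply/hasPn => i; rewrite mem_iota -leqNgt.
by case/andP.
Qed.

Lemma count_ltn_conj (s : seq nat) (j : nat) :
  sorted geq s -> count (ltn j) (conj_part s) = nth 0 s j.
Proof.
move=> ss; rewrite count_map -[RHS](count_ltn_iota (nth_le_head j ss)).
by apply: eq_count => i /=; rewrite ltn_nth_count.
Qed.

Lemma head_conj (s : seq nat) : all (ltn 0) s -> head 0 (conj_part s) = size s.
Proof. by case: s => //= -[|a] s //=; rewrite all_count => /eqP ->. Qed.

Lemma conj_partK (s : seq nat) :
  sorted geq s -> all (ltn 0) s -> conj_part (conj_part s) = s.
Proof.
move=> ss pos; apply: (@eq_from_nth _ 0); first by rewrite size_map size_iota head_conj.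
move=> j; rewrite size_map size_iota => js.
by rewrite (nth_map 0) ?size_iota // nth_iota // add0n count_ltn_conj.
Qed.

Lemma conj_part_partition (n : nat) (s : seq nat) :
  is_partition n s -> is_partition n (conj_part s).
Proof.
case/and3P=> ss pos /eqP <-; apply/and3P; split.
- apply: (homo_sorted (e := leq)); last exact: iota_sorted.
  by move=> i j ij; apply: sub_count => x /=; apply: leq_ltn_trans.
- apply/allP => _ /mapP[i + ->]; rewrite mem_iota => /andP[_ ih].
  by rewrite /= -ltn_nth_count // nth0.
- rewrite sumnE big_map.
  (* The cells are counted twice: each column length becomes a sum of indicators over the rows, and
     after the exchange a row [x] contributes its [x] columns. *)
  under eq_bigr => i _ do rewrite -sum1_count big_mkcond /=.
  rewrite exchange_big /= sumnE; apply/eqP/eq_big_seq => x /(nthP 0)[j _ <-].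
  by rewrite -big_mkcond sum1_count count_ltn_iota // nth_le_head.
Qed.

(** The parts equal to [d.+1] are those exceeding [d] but not [d.+1], and [count_ltn_conj] counts
    both kinds. *)
Lemma count_mem_conj (s : seq nat) (d : nat) : sorted geq s ->
  count_mem d.+1 (conj_part s) = nth 0 s d - nth 0 s d.+1.
Proof.
move=> ss; rewrite -!count_ltn_conj //; set t := conj_part s.
suff -> : count (ltn d) t = count_mem d.+1 t + count (ltn d.+1) t by rewrite addnK.
rewrite -count_predUI [X in _ = _ + X](_ : _ = 0) ?addn0.
  by apply: eq_count => x /=; rewrite leq_eqVlt eq_sym.
rewrite (eq_count (a2 := pred0)) ?count_pred0 // => x /=.
by case: eqVneq => // ->; rewrite ltnn.
Qed.

(** Equal parts form contiguous blocks, so neighbours in [undup s] are the neighbours in [s] across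
    a block boundary. *)
Lemma parity_alternatingE (s : seq nat) : sorted geq s ->
  parity_alternating s = sorted (fun a b => (a == b) || (odd a != odd b)) s.
Proof.
rewrite /parity_alternating; elim: s => //= a [|b s] //= IH /andP[ba pbs].
have ab : (a \in b :: s) = (a == b).
  rewrite inE; case: eqVneq => //= nab; apply/negP => as_.
  have /allP/(_ a as_) ab := order_path_min (rev_trans leq_trans) pbs.
  by move: nab; rewrite eqn_leq ab ba.
rewrite ab; case: eqVneq => [_|_] /=; first exact: IH.
(* [undup] keeps last occurrences, but sortedness still puts the value [b] first. *)
have [u E] : exists u, undup (b :: s) = b :: u.
  elim: s pbs {IH ab} => [_|c s IHs /= /andP[cb pcs]]; first by exists [::].
  rewrite inE; case: eqVneq => [ebc|nbc] /=.
    by subst c; have [u /= ->] := IHs pcs; exists u.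
  case: ifP => [bs|_]; last by eexists.
  have /allP/(_ b bs) bc := order_path_min (rev_trans leq_trans) pcs.
  by move: nbc; rewrite eqn_leq bc cb.
by move: (IH pbs) E => /= <- ->.
Qed.

(** The exempt size [size s] corresponds to the drop from the last part of [s] to the default 0,
    which parity alternation does not constrain either. *)
Lemma nonlargest_odd_mult_conj (n : nat) (s : seq nat) : is_partition n s ->
  nonlargest_odd_mult (conj_part s) = parity_alternating s.
Proof.
move=> ps; have /and3P[ss pos _] := ps.
have /and3P[_ /allP cpos _] := conj_part_partition ps.
rewrite parity_alternatingE // /nonlargest_odd_mult head_conj //.
have nthS j : nth 0 s j.+1 <= nth 0 s j.
  have [js|js] := ltnP j.+1 (size s); last by rewrite nth_default.
  by move/(sortedP 0): ss; apply.
have mem_conj d : (d.+1 \in conj_part s) = (nth 0 s d != nth 0 s d.+1).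
  by rewrite -has_pred1 has_count count_mem_conj // subn_gt0 ltn_neqAle nthS andbT eq_sym.
have odd_conj d : odd (count_mem d.+1 (conj_part s)) = (odd (nth 0 s d) != odd (nth 0 s d.+1)).
  by rewrite count_mem_conj // oddB //; do 2 case: odd.
apply/allP/(sortedP 0) => [odd_s j js | alt [|d] dc]; last 2 first.
- by have := cpos _ dc.
- rewrite odd_conj; apply/implyP => dn; move: dc; rewrite mem_conj => ne.
  (* Past the end both entries are the default 0, so [ne] gives [d.+1 <= size s]; equality is the
     exempt largest part. *)
  have ds : d.+1 < size s.
    rewrite ltn_neqAle dn ltnNge; apply: contra ne => sd.
    by rewrite !nth_default // leqW.
  by have := alt d ds; rewrite (negPf ne).
- case: eqVneq => //= ne; rewrite -odd_conj.
  by have := odd_s j.+1; rewrite mem_conj (ltn_eqF js); exact.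
Qed.

(** This supplies a list for [num_partitionsE], so that the two counts can be compared by mapping
    one list. *)
Lemma partition_enum (n : nat) (P : pred (seq nat)) : exists l : seq (seq nat),
  uniq l /\ (forall s, (s \in l) = is_partition n s && P s).
Proof.
exists [seq s <- undup [seq map val (s : {bseq n of 'I_n.+1}) | s : {bseq n of 'I_n.+1}]
       | is_partition n s && P s]; split; first by rewrite filter_uniq ?undup_uniq.
move=> s; rewrite mem_filter mem_undup andb_idr // => /andP[/and3P[_ pos /eqP sm] _].
have sz : size (map (@inord n) s) <= n by rewrite size_map -[leqRHS]sm size_le_sumn.
apply/mapP; exists (Bseq sz); first by rewrite mem_enum.
rewrite /= -map_comp -[LHS]map_id; apply/eq_in_map => x /mem_le_sumn xs /=.
by rewrite inordK // ltnS -sm.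
Qed.

Theorem theorem3p1 (n : nat) (hn : 0 < n) : pa n = po_star n.
Proof.
have [l [ul meml]] := partition_enum n parity_alternating.
have conjK s : is_partition n s -> conj_part (conj_part s) = s.
  by case/and3P=> ss pos _; apply: conj_partK.
rewrite /pa /po_star (num_partitionsE ul meml) -(size_map conj_part).
(* The conjugated list enumerates the partitions counted by [po_star]: involutivity gives both
   distinctness and preimages. *)
symmetry; apply: num_partitionsE => [|s].
  rewrite map_inj_in_uniq // => s t; rewrite !meml.
  by move=> /andP[ps _] /andP[pt _] E; rewrite -(conjK s) // E conjK.
apply/mapP/andP => [[t]|[ps Ps]].
  rewrite meml => /andP[pt Pt] ->.
  by rewrite (nonlargest_odd_mult_conj pt) conj_part_partition.
have pc := conj_part_partition ps.
exists (conj_part s); last by rewrite conjK.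
by rewrite meml pc -(nonlargest_odd_mult_conj pc) conjK.
Qed.
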